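(* Let $\mathcal{A}=\{A_1,\dots,A_p\}$ be a finite set of $n\times n$ nonnegative matrices which is positively-irreducible, and let $d\geq 0$ be an integer. Then the nonlinear eigenproblem: find a scalar $\lambda_d$ and $u=(u_s)_{s\in[p]^d}\in\prod_{s\in[p]^d}\mathbb{R}_+^n$, $u\neq 0$, such that $T^d(u)=\lambda_d u$, has a solution. Moreover, any such solution $(\lambda_d,u)$ satisfies $$\rho(\mathcal{A})\leq\lambda_d\leq r(T^d),$$ and the map $\|x\|_u:=\max_{s\in[p]^d}\langle u_s,x\rangle$ is a monotone $\lambda_d$-extremal hemi-norm on $\mathbb{R}_+^n$; that is, it is a monotone hemi-norm and $$\max_{1\leq a\leq p}\|A_a x\|_u\leq\lambda_d\|x\|_u\quad\text{for all }x\in\mathbb{R}_+^n.$$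
   Context: $[p]=\{1,\dots,p\}$; $\mathbb{R}_+^n$ is the closed cone of vectors with nonnegative entries; $\leq$ is the entrywise order; suprema of vectors are taken entrywise. Joint spectral radius: $\rho(\mathcal{A})=\lim_{k\to\infty}\max_{1\leq i_1,\dots,i_k\leq p}\|A_{i_1}\cdots A_{i_k}\|^{1/k}$. The faces of $\mathbb{R}_+^n$ are the sets $\{x\in\mathbb{R}_+^n: x_i=0\text{ if }i\notin I\}$, $I\subseteq\{1,\dots,n\}$; those with $I=\emptyset$ and $I=\{1,\dots,n\}$ are trivial. A set of nonnegative matrices is positively-irreducible if no non-trivial face of $\mathbb{R}_+^n$ is left invariant by all matrices of the set. The operator $T^d$: let $\tau^d:[p]^d\times[p]\to[p]^d$ be $\tau^d(i_1\cdots i_d,a)=i_2\cdots i_d a$ (for $d=0$, $[p]^0$ consists only of the empty word and $\tau^0$ is constant). $T^d$ is the self-map of $\prod_{s\in[p]^d}\mathbb{R}_+^n$ sending $x=(x_s)_s$ to the vector with $s$-component $T^d_s(x)=\sup_{r\in[p]^d,\,a\in[p]:\ \tau^d(r,a)=s}A_a^T x_r$. In particular $T^0(x)=\sup_{1\leq a\leq p}A_a^Tx$. Spectral radius of a monotone ($x\leq y\Rightarrow f(x)\leq f(y)$), positively homogeneous ($f(\lambda x)=\lambda f(x)$ for $\lambda>0$) self-map $f$ of a cone $\mathcal{C}$: $r(f)=\lim_{k\to\infty}\|f^k(x)\|^{1/k}$ for $x\in\operatorname{int}\mathcal{C}$ (independent of the choice of $x$ and of the norm). A map $\nu:\mathbb{R}_+^n\to\mathbb{R}$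 is a monotone hemi-norm if it is convex, positively homogeneous of degree $1$, if $0\leq x\leq y$ implies $\nu(x)\leq\nu(y)$, and if $\nu(x)=0$ with $x\geq 0$ implies $x=0$. It is a monotone $\lambda$-extremal hemi-norm if moreover $\max_{a}\nu(A_ax)\leq\lambda\nu(x)$ for all $x\in\mathbb{R}_+^n$. *)

(* Defs.v *)
From HB Require Import structures.
From mathcomp Require Import all_boot all_order all_algebra.
From mathcomp Require Import all_classical all_reals all_analysis.

Set Implicit Arguments.
Unset Strict Implicit.
Unset Printing Implicit Defensive.

Import Order.TTheory GRing.Theory Num.Theory.
Import numFieldNormedType.Exports.

Local Open Scope classical_set_scope.
Local Open Scope ring_scope.

Definition vle (R : realType) (n : nat) (x y : 'cV[R]_n) : Prop :=
  forall i, x i ord0 <= y i ord0.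

Definition nncone (R : realType) (n : nat) : set 'cV[R]_n :=
  [set x | vle 0 x].

Definition cone_face (R : realType) (n : nat) (I : {set 'I_n}) : set 'cV[R]_n :=
  [set x | nncone x /\ forall i, i \notin I -> x i ord0 = 0].

Definition positively_irreducible (R : realType) (n p : nat)
    (A : 'I_p -> 'M[R]_n) : Prop :=
  forall I : {set 'I_n}, I <> finset.set0 -> I <> [set: 'I_n]%SET ->
    ~ (forall a x, cone_face I x -> cone_face I (A a *m x)).

(* The matrix norm is the library's entrywise sup norm; the limit does not
   depend on the norm.  The term k = 0 is irrelevant. *)
Definition joint_spectral_radius (R : realType) (n p : nat)
    (A : 'I_p -> 'M[R]_n) : R :=
  lim ((fun k : nat =>
    (\big[Num.max/0]_(w : k.-tuple 'I_p)
       `|\big[mulmx/1%:M]_(a <- w) A a|) `^ k%:R^-1) @ \oo).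

Definition prod_nncone (R : realType) (n : nat) (S : finType) :
    set (S -> 'cV[R]_n) :=
  [set x | forall s, nncone (x s)].

Definition prod_norm (R : realType) (n : nat) (S : finType)
    (x : S -> 'cV[R]_n) : R :=
  \big[Num.max/0]_s `|x s|.

(* The iterate k = 0 contributes one irrelevant term.  [prod_topology T] is
   convertible to [forall s, T s] and carries the product topology. *)
Definition is_cone_spectral_radius (R : realType) (n : nat) (S : finType)
    (f : (S -> 'cV[R]_n) -> (S -> 'cV[R]_n)) (r : R) : Prop :=
  forall x : S -> 'cV[R]_n,
    interior (@prod_nncone R n S : set (prod_topology (fun=> 'cV[R]_n))) x ->
    (fun k : nat => prod_norm (iter k f x) `^ k%:R^-1) @ \oo --> r.

Definition cone_spectral_radius (R : realType) (n : nat) (S : finType)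
    (f : (S -> 'cV[R]_n) -> (S -> 'cV[R]_n)) : R :=
  [get r | is_cone_spectral_radius f r].

(* Drops the first letter of the word r a, so that the case d = 0 yields the
   constant map to the empty word. *)
Definition tau (p d : nat) (r : d.-tuple 'I_p) (a : 'I_p) : d.-tuple 'I_p :=
  behead_tuple (rcons_tuple r a).

(* For nonnegative matrices and x in the product cone, every term of the
   maximum is nonnegative and (for p > 0) the index set is nonempty, so the
   neutral element 0 does not affect the supremum. *)
Definition path_operator (R : realType) (n p d : nat) (A : 'I_p -> 'M[R]_n)
    (x : d.-tuple 'I_p -> 'cV[R]_n) (s : d.-tuple 'I_p) : 'cV[R]_n :=
  \col_i \big[Num.max/0]_(ra : d.-tuple 'I_p * 'I_p | tau ra.1 ra.2 == s)
    ((A ra.2)^T *m x ra.1) i ord0.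

Definition path_eigenpair (R : realType) (n p d : nat) (A : 'I_p -> 'M[R]_n)
    (lambda : R) (u : d.-tuple 'I_p -> 'cV[R]_n) : Prop :=
  [/\ prod_nncone u, u <> 0 & path_operator A u = lambda *: u].

Definition dot (R : realType) (n : nat) (x y : 'cV[R]_n) : R :=
  \sum_i x i ord0 * y i ord0.

(* For u in the product cone and x in the cone, all terms are nonnegative. *)
Definition max_linear (R : realType) (n : nat) (S : finType)
    (u : S -> 'cV[R]_n) (x : 'cV[R]_n) : R :=
  \big[Num.max/0]_s dot (u s) x.

(* A map on the cone is represented by a total function, which the conditions
   below only constrain on the cone. *)
Definition monotone_heminorm (R : realType) (n : nat) (nu : 'cV[R]_n -> R) :
    Prop :=
  [/\ @convex_function R 'cV[R]_n (@nncone R n) nu,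
      forall (t : R) x, 0 < t -> nncone x -> nu (t *: x) = t * nu x,
      forall x y, nncone x -> vle x y -> nu x <= nu y
    & forall x, nncone x -> nu x = 0 -> x = 0].

(* A monotone hemi-norm vanishes at 0, hence is nonnegative on the cone, so the
   neutral element 0 does not affect the maximum. *)
Definition monotone_extremal_heminorm (R : realType) (n p : nat)
    (A : 'I_p -> 'M[R]_n) (lambda : R) (nu : 'cV[R]_n -> R) : Prop :=
  monotone_heminorm nu /\
  forall x, nncone x -> \big[Num.max/0]_a nu (A a *m x) <= lambda * nu x.

(* Main.v *)
(* Existence of an eigenvector for T avoids Brouwer's theorem. Let r be the
   Collatz-Wielandt number of T, the infimum of the mu such that T x <= mu x for
   some x > 0. For mu > r the order interval between 1 and a large multiple of
   such an x is mapped into itself by x |-> 1 + T x / mu, so Tarski's theorem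
   gives x with T x = mu (x - 1). Normalised and with mu tending to r, these x
   accumulate at an eigenvector of eigenvalue r. Comparing iterates of T with the
   eigenvector from below and with the supersolutions from above shows that r is
   also the spectral radius of T, which dominates every other eigenvalue.
   If T u = lambda u, then A_a^T u_r <= lambda u_s for s = tau r a, and pairing
   with x gives ||A_a x||_u <= lambda ||x||_u. Irreducibility makes ||.||_u
   definite, so products of length k have norm O(lambda^k); the limit defining
   the joint spectral radius exists by Fekete's lemma. *)

Require Import Defs.
From mathcomp Require Import all_boot all_order all_algebra.
From mathcomp Require Import all_classical all_reals all_analysis.
From mathcomp Require Import ring lra.

Set Implicit Arguments.
Unset Strict Implicit.
Unset Printing Implicit Defensive.

Import Order.TTheory GRing.Theory Num.Theory.
Import numFieldNormedType.Exports.

Local Open Scope classical_set_scope.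
Local Open Scope ring_scope.

(** * Collatz-Wielandt numbers *)

(** Knaster-Tarski: the fixed point is the entrywise supremum of the points [y] of the interval with
    [y <= G y]. *)
Lemma tarski_interval (R : realType) (I : Type) (G : (I -> R) -> I -> R)
    (l z : I -> R) (l_le_z : forall i, l i <= z i)
    (G_mono : forall x y, (forall i, l i <= x i) -> (forall i, x i <= y i) ->
       forall i, G x i <= G y i)
    (Gl : forall i, l i <= G l i) (Gz : forall i, G z i <= z i) :
  exists2 x, forall i, l i <= x i & forall i, G x i = x i.
Proof.
pose S := [set y | forall i, l i <= y i <= z i /\ y i <= G y i].
have Sl : S l by move=> i; rewrite lexx l_le_z.
pose x i := sup [set y i | y in S].
have Sub i : ubound [set y i | y in S] (z i).
  by move=> _ [y Sy <-]; have [/andP[]] := Sy i.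
have leS y i : S y -> y i <= x i.
  by move=> Sy; apply: ub_le_sup; [exists (z i) | exists y].
have lx i : l i <= x i by apply: leS.
have xz i : x i <= z i.
  by apply: ge_sup => //; exists (l i), l.
have xG i : x i <= G x i.
  apply: ge_sup; first by exists (l i), l.
  move=> _ [y Sy <-]; apply: le_trans (_ : G y i <= _).
    by have [] := Sy i.
  by apply: G_mono => j; [have [/andP[]] := Sy j | exact: leS].
exists x => // i; apply/eqP; rewrite eq_le xG andbT.
(* By monotonicity [G x] again belongs to [S], so it lies below the supremum [x]. *)
apply: leS => j; split; last first.
  by apply: G_mono => // k; rewrite (le_trans (lx k)).
rewrite (le_trans (lx j))//=; apply: le_trans (Gz j).
exact: G_mono.
Qed.

Definition cw_bounds (R : realType) (I : Type) (F : (I -> R) -> I -> R) : set R :=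
  [set mu | exists2 x : I -> R, forall i, 0 < x i & forall i, F x i <= mu * x i].

Definition cw_number (R : realType) (I : Type) (F : (I -> R) -> I -> R) : R :=
  inf (cw_bounds F).

Lemma cw_bounds_ge0 (R : realType) (I : Type) (F : (I -> R) -> I -> R) (i0 : I)
    (F_ge0 : forall x, (forall i, 0 <= x i) -> forall i, 0 <= F x i) :
  lbound (cw_bounds F) 0.
Proof.
move=> mu [x x_gt0 Fx].
have := le_trans (F_ge0 x (fun i => ltW (x_gt0 i)) i0) (Fx i0).
by rewrite pmulr_lge0.
Qed.

Lemma cw_bounds_neq0 (R : realType) (I : finType) (F : (I -> R) -> I -> R) :
  cw_bounds F !=set0.
Proof.
exists (\big[Num.max/0]_i F (fun=> 1) i), (fun=> 1) => i.
  exact: ltr01.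
by rewrite mulr1; exact: le_bigmax.
Qed.

(** The equation says that [x] is fixed by [x |-> 1 + F x / mu]. The gap between [nu] and [mu]
    leaves room to absorb the added 1 in a large multiple of the vector [y] witnessing [nu]. *)
Lemma cw_bounds_fixpoint (R : realType) (I : finType) (F : (I -> R) -> I -> R)
    (F_ge0 : forall x, (forall i, 0 <= x i) -> forall i, 0 <= F x i)
    (F_mono : forall x y, (forall i, 0 <= x i) -> (forall i, x i <= y i) ->
       forall i, F x i <= F y i)
    (F_hom : forall t x, 0 <= t -> (forall i, 0 <= x i) ->
       forall i, F (fun j => t * x j) i = t * F x i)
    (nu mu : R) (mu_gt0 : 0 < mu) (nu_lt_mu : nu < mu) (nuF : cw_bounds F nu) :
  exists2 x : I -> R, forall i, 1 <= x i & forall i, F x i = mu * (x i - 1).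
Proof.
have [y y_gt0 Fy] := nuF.
(* Chosen so that [mu <= (mu - nu) c y], which amounts to [1 + nu c y / mu <= c y]: the upper end
   [c y] of the interval is not moved up. *)
pose c := \big[Num.max/0]_i (mu / ((mu - nu) * y i)).
have c_ge0 : 0 <= c by exact: bigmax_ge_id.
have c_ge i : mu <= (mu - nu) * (c * y i).
  have : mu / ((mu - nu) * y i) <= c by exact: le_bigmax.
  rewrite ler_pdivrMr; last by rewrite mulr_gt0 ?subr_gt0.
  by rewrite mulrCA.
have Gz i : 1 + mu^-1 * F (fun j => c * y j) i <= c * y i.
  rewrite F_hom//; last by move=> j; exact: ltW.
  have h : c * F y i <= c * (nu * y i) by exact: ler_wpM2l.
  rewrite -(ler_pM2l mu_gt0) mulrDr mulrA divff ?gt_eqF// mulr1 mul1r.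
  by have := c_ge i; lra.
have lz i : 1 <= c * y i.
  apply: le_trans (Gz i); rewrite lerDl mulr_ge0//; first by rewrite invr_ge0 ltW.
  by apply: F_ge0 => j; rewrite mulr_ge0// ltW.
have [] := @tarski_interval R I (fun x i => 1 + mu^-1 * F x i) (fun=> 1) _ lz.
- move=> x x' x_ge1 xx' i; rewrite lerD2l ler_wpM2l ?invr_ge0 ?(ltW mu_gt0)//.
  by apply: F_mono => // j; apply: le_trans (x_ge1 j).
- move=> i; rewrite lerDl mulr_ge0//; first by rewrite invr_ge0 ltW.
  exact: F_ge0.
- exact: Gz.
move=> x x_ge1 Gx; exists x => // i.
by rewrite -[in RHS]Gx addrAC subrr add0r mulrA divff ?mul1r// gt_eqF.
Qed.

(* If [F x = mu (x - 1)] and [N] is the largest entry of [x], then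
   [mu (1 - 1/N)] is an upper Collatz-Wielandt bound, so the defect [mu / N] of
   the normalised vector [x / N] is at most [mu - cw_number F]. *)
Lemma cw_approx_eigenvector (R : realType) (I : finType)
    (F : (I -> R) -> I -> R) (i0 : I)
    (F_ge0 : forall x, (forall i, 0 <= x i) -> forall i, 0 <= F x i)
    (F_mono : forall x y, (forall i, 0 <= x i) -> (forall i, x i <= y i) ->
       forall i, F x i <= F y i)
    (F_hom : forall t x, 0 <= t -> (forall i, 0 <= x i) ->
       forall i, F (fun j => t * x j) i = t * F x i)
    (e : R) (e_gt0 : 0 < e) :
  exists v : I -> R, [/\ forall i, 0 <= v i <= 1, exists i, v i = 1
    & forall i, `|F v i - cw_number F * v i| <= e].
Proof.
set r := cw_number F.
have cw_inf : has_inf (cw_bounds F).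
  by split; [exact: cw_bounds_neq0 | exists 0; exact: cw_bounds_ge0].
have r_ge0 : 0 <= r.
  by apply: lb_le_inf; [exact: cw_bounds_neq0 | exact: cw_bounds_ge0].
have [nu nuF nu_lt] := inf_adherent e_gt0 cw_inf.
pose mu := r + e.
have mu_gt0 : 0 < mu by rewrite /mu; lra.
have [x x_ge1 Fx] := cw_bounds_fixpoint F_ge0 F_mono F_hom mu_gt0 nu_lt nuF.
have [j _ xj] := @arg_maxP _ _ _ i0 predT x isT.
set N := x j.
have N_gt0 : 0 < N by exact: lt_le_trans (x_ge1 j).
have x_le i : x i / N <= 1 by rewrite ler_pdivrMr// mul1r; exact: xj.
have r_le : r <= mu * (1 - N^-1).
  apply: ge_inf; first by exists 0; exact: cw_bounds_ge0.
  exists x => i; first exact: lt_le_trans (x_ge1 i).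
  rewrite Fx -mulrA ler_pM2l// mulrBl mul1r mulrC lerD2l lerN2.
  exact: x_le.
exists (fun i => N^-1 * x i); split => [i||i].
- by rewrite mulr_ge0 ?invr_ge0 ?(ltW N_gt0)// 1?mulrC//= (le_trans ler01).
- by exists j; rewrite mulVf// gt_eqF.
- rewrite F_hom ?invr_ge0 ?(ltW N_gt0)//; last by move=> k; exact: le_trans (x_ge1 k).
  (* Both terms on the right lie between 0 and [e], the second because [r_le] reads
     [mu / N <= mu - r = e]. *)
  have -> : N^-1 * F x i - r * (N^-1 * x i) = e * (x i / N) - mu * N^-1.
    by rewrite Fx /mu; lra.
  have h1 : 0 <= e * (x i / N) <= e.
    have xN_ge0 : 0 <= x i / N.
      by rewrite divr_ge0 ?(ltW N_gt0)// (le_trans ler01 (x_ge1 i)).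
    by rewrite mulr_ge0 ?(ltW e_gt0)//= ler_piMr ?(ltW e_gt0).
  have h2 : 0 <= mu * N^-1 by rewrite mulr_ge0 ?invr_ge0 ?(ltW mu_gt0) ?(ltW N_gt0).
  have h3 : mu * N^-1 <= e by move: r_le; rewrite /mu; lra.
  by rewrite ler_norml; lra.
Qed.

(** Compactness of the cube, by Tychonoff. A cluster point approached at arbitrarily late indices
    replaces the limit of a subsequence; finiteness of [I] makes the approximation uniform in
    [i]. *)
Lemma cube_cluster_point (R : realType) (I : finType)
    (v : nat -> I -> R) (v01 : forall k i, 0 <= v k i <= 1) :
  exists2 u : I -> R, forall i, 0 <= u i <= 1 &
    forall (e : R) (m : nat), 0 < e -> exists2 k, (m <= k)%N &
      forall i, `|u i - v k i| < e.
Proof.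
pose T := prod_topology (fun _ : I => R : topologicalType).
have K := @tychonoff _ (fun _ : I => R : topologicalType) _
  (fun _ : I => @segment_compact R 0 1).
have [] := K ((v : nat -> T) @ \oo) _.
  by exists 0%N => // k _ i /=; rewrite in_itv/=.
move=> u [u01 clu]; exists u => [i|e m e_gt0].
  by have := u01 i; rewrite /= in_itv.
have near_v : ((v : nat -> T) @ \oo) [set w | exists2 k, (m <= k)%N & w = v k].
  by exists m => // k /= mk; exists k.
have near_ui i : nbhs u [set w : T | `|u i - w i| < e].
  have /= := @proj_continuous _ (fun _ : I => R : topologicalType) i u
    (ball (u i : R) e) (nbhsx_ballx _ _ e_gt0).
  by [].
have near_u : nbhs u [set w : T | forall i, `|u i - w i| < e].
  exact: (@filter_forall T I _ _ (nbhs_filter u) near_ui).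
by have [_ [[k mk ->] uk]] := clu _ _ near_v near_u; exists k.
Qed.

(** A cluster point of normalised approximate eigenvectors, with errors tending to 0, is an exact
    eigenvector: [F_lip] supplies both monotonicity and the continuity needed in the limit. *)
Lemma cw_eigenvector (R : realType) (I : finType)
    (F : (I -> R) -> I -> R) (i0 : I) (L : R) (L_ge0 : 0 <= L)
    (F_ge0 : forall x, (forall i, 0 <= x i) -> forall i, 0 <= F x i)
    (F_lip : forall x y e, 0 <= e -> (forall i, 0 <= x i) ->
       (forall i, 0 <= y i) -> (forall i, x i <= y i + e) ->
       forall i, F x i <= F y i + L * e)
    (F_hom : forall t x, 0 <= t -> (forall i, 0 <= x i) ->
       forall i, F (fun j => t * x j) i = t * F x i) :
  exists u : I -> R, [/\ forall i, 0 <= u i, exists i, u i != 0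
    & forall i, F u i = cw_number F * u i].
Proof.
have F_mono x y : (forall i, 0 <= x i) -> (forall i, x i <= y i) ->
    forall i, F x i <= F y i.
  move=> x_ge0 xy i; rewrite -[leRHS]addr0 -[X in _ + X](mulr0 L).
  by apply: F_lip => // j; rewrite ?addr0// (le_trans (x_ge0 j)).
set r := cw_number F.
have r_ge0 : 0 <= r.
  by apply: lb_le_inf; [exact: cw_bounds_neq0 | exact: cw_bounds_ge0].
have /choice[v vP] : forall k : nat, exists v : I -> R,
    [/\ forall i, 0 <= v i <= 1, exists i, v i = 1
      & forall i, `|F v i - r * v i| <= k.+1%:R^-1].
  by move=> k; apply: cw_approx_eigenvector; rewrite ?invr_gt0.
have v01 k i : 0 <= v k i <= 1 by have [] := vP k.
have [u u01 uv] := cube_cluster_point v01.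
have u_ge0 i : 0 <= u i by have /andP[] := u01 i.
have v_ge0 k i : 0 <= v k i by have /andP[] := v01 k i.
exists u; split => // [|i].
  (* Some entry of [v k] equals 1 and is at distance less than 1 from that of [u], which is
     therefore nonzero. *)
  have [k _ uk] := uv 1 0 ltr01; have [_ [i vi] _] := vP k.
  exists i; apply/eqP => ui; have := uk i.
  by rewrite ui vi sub0r normrN normr1 ltxx.
have lin (a b s t x y z w : R) : a <= b + x -> b <= a + x ->
    `|b - t| <= w -> `|s - t| <= y -> w <= z -> `|a - s| <= x + y + z.
  by rewrite !ler_norml; lra.
apply/eqP; rewrite -subr_eq0 -normr_le0; apply/ler_addgt0Pr => /= e e_gt0.
rewrite add0r.
(* The three errors, from [F u] against [F (v k)], from [r u] against [r v k] and from the defect of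
   [v k], are at most [L d], [r d] and [d]; taking [d = e / c] makes their sum [e]. *)
pose c := L + r + 1; have c_gt0 : 0 < c by rewrite /c; lra.
pose d : R := e / c; have d_gt0 : 0 < d by rewrite divr_gt0.
have [k mk uk] := uv d (Num.bound d^-1) d_gt0.
have k_le : k.+1%:R^-1 <= d.
  rewrite -[d]invrK lef_pV2 ?posrE ?invr_gt0//.
  apply: le_trans (ltW (archi_boundP _)) _; first by rewrite invr_ge0 ltW.
  by rewrite ler_nat ltnW.
have [_ _ Fv] := vP k.
have Fuv : F u i <= F (v k) i + L * d.
  apply: F_lip => //; first exact: ltW.
  by move=> j; have := uk j; rewrite ltr_norml; lra.
have Fvu : F (v k) i <= F u i + L * d.
  apply: F_lip => //; first exact: ltW.
  by move=> j; have := uk j; rewrite ltr_norml; lra.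
have ruv : `|r * u i - r * v k i| <= r * d.
  by rewrite -mulrBr normrM ger0_norm// ler_wpM2l// ltW.
have de : e = L * d + r * d + d.
  have c_neq0 := lt0r_neq0 c_gt0.
  by rewrite -[LHS](mulfVK c_neq0) -/d /c; ring.
rewrite de; exact: lin Fuv Fvu (Fv i) ruv k_le.
Qed.

(** * Limits of roots *)

Lemma cvg_powR_invn (R : realType) (c : R) :
  0 < c -> (fun k : nat => c `^ k%:R^-1) @ \oo --> (1 : R).
Proof.
move=> c_gt0.
have inv0 : (fun k : nat => (k%:R^-1 : R)) @ \oo --> (0 : R).
  by rewrite -cvg_shiftS; exact: cvg_harmonic.
have -> : (fun k : nat => c `^ k%:R^-1) = (fun k => expR (k%:R^-1 * ln c)).
  by apply/funext => k; rewrite /powR gt_eqF.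
have ln0 : (fun k : nat => k%:R^-1 * ln c) @ \oo --> (0 : R).
  by rewrite -[X in _ --> X](mul0r (ln c)); exact: cvgMr_tmp.
by have := cvg_comp _ _ ln0 (@continuous_expR R 0); rewrite expR0.
Qed.

Lemma exprn_powR_invn (R : realType) (x : R) (k : nat) :
  0 <= x -> (0 < k)%N -> (x ^+ k) `^ k%:R^-1 = x.
Proof.
by move=> x_ge0 k_gt0; rewrite -powR_mulrn// -powRrM mulfV ?pnatr_eq0 ?gtn_eqF// powRr1.
Qed.

Lemma ler_root (R : realType) (k : nat) (x y : R) :
  0 <= x -> x <= y -> x `^ k%:R^-1 <= y `^ k%:R^-1.
Proof.
move=> x_ge0 xy; apply: ge0_ler_powR => //; rewrite ?invr_ge0// nnegrE//.
exact: le_trans xy.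
Qed.

Lemma cvg_root_geometric (R : realType) (c q : R) : 0 < c -> 0 <= q ->
  (fun k : nat => (c * q ^+ k) `^ k%:R^-1) @ \oo --> q.
Proof.
move=> c_gt0 q_ge0.
have cq : (fun k : nat => c `^ k%:R^-1 * q) @ \oo --> q.
  by rewrite -[X in _ --> X]mul1r; apply: cvgMr_tmp; exact: cvg_powR_invn.
apply: cvg_trans cq; apply: near_eq_cvg; near=> k.
(* At [k = 0] the exponent is [0^-1 = 0] and every root is 1, so the identity is only claimed for
   positive [k]. *)
have k_gt0 : (0 < k)%N by near: k; exact: nbhs_infty_gt.
by rewrite powRM ?exprn_ge0 ?(ltW c_gt0)// exprn_powR_invn.
Unshelve. all: by end_near. Qed.

Lemma geometric_le_root_lim (R : realType) (b : nat -> R) (c q r : R) :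
    0 < c -> 0 <= q -> (forall k, c * q ^+ k <= b k) ->
  (fun k : nat => b k `^ k%:R^-1) @ \oo --> r -> q <= r.
Proof.
move=> c_gt0 q_ge0 cb b_r; have cq_q := cvg_root_geometric c_gt0 q_ge0.
apply: ler_cvg_to cq_q b_r _.
apply: nearW => k.
have cq_ge0 : 0 <= c * q ^+ k by rewrite mulr_ge0 ?exprn_ge0 ?(ltW c_gt0).
by rewrite ler_root ?cq_ge0.
Qed.

Lemma root_lim_le_geometric (R : realType) (b : nat -> R) (c q r : R) :
    0 < c -> 0 <= q -> (forall k, 0 <= b k <= c * q ^+ k) ->
  (fun k : nat => b k `^ k%:R^-1) @ \oo --> r -> r <= q.
Proof.
move=> c_gt0 q_ge0 cb b_r; have cq_q := cvg_root_geometric c_gt0 q_ge0.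
apply: ler_cvg_to b_r cq_q _.
apply: nearW => k; have /andP[b_ge0 b_le] := cb k.
by rewrite ler_root ?b_ge0.
Qed.

(** Squeezes the roots of [b k] between those of [c r^k] and [C mu^k] with [mu = r + e / 2];
    multiplicative constants disappear in the limit. *)
Lemma cvg_root_growth (R : realType) (b : nat -> R) (c r : R) :
    0 < c -> 0 <= r -> (forall k, c * r ^+ k <= b k) ->
    (forall mu, r < mu -> exists C, forall k, b k <= C * mu ^+ k) ->
  (fun k : nat => b k `^ k%:R^-1) @ \oo --> r.
Proof.
move=> c_gt0 r_ge0 cb bC; apply/cvgrPdist_le => e e_gt0.
pose mu := r + e / 2.
have mu_gt0 : 0 < mu by rewrite /mu; lra.
have [C0 bC0] := bC mu ltac:(rewrite /mu; lra).
pose C := Num.max C0 1.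
have C_gt0 : 0 < C by rewrite /C lt_max ltr01 orbT.
have /cvgrPdist_le/(_ e e_gt0) lo := cvg_root_geometric c_gt0 r_ge0.
have e2_gt0 : 0 < e / 2 by lra.
have /cvgrPdist_le/(_ _ e2_gt0) hi := cvg_root_geometric C_gt0 (ltW mu_gt0).
near=> k.
have cr_ge0 : 0 <= c * r ^+ k by rewrite mulr_ge0 ?exprn_ge0 ?(ltW c_gt0).
have lo_k : (c * r ^+ k) `^ k%:R^-1 <= b k `^ k%:R^-1.
  by rewrite ler_root ?cr_ge0.
have b_le : b k <= C * mu ^+ k.
  apply: le_trans (bC0 k) _; rewrite ler_wpM2r ?exprn_ge0 ?(ltW mu_gt0)//.
  by rewrite /C le_max lexx.
have hi_k : b k `^ k%:R^-1 <= (C * mu ^+ k) `^ k%:R^-1.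
  have b_ge0 := le_trans cr_ge0 (cb k).
  by rewrite ler_root ?b_ge0.
have lo_e : `|r - (c * r ^+ k) `^ k%:R^-1| <= e by near: k.
have hi_e : `|mu - (C * mu ^+ k) `^ k%:R^-1| <= e / 2 by near: k.
by move: lo_e hi_e; rewrite !ler_norml /mu; lra.
Unshelve. all: by end_near. Qed.

(** * Monotone homogeneous maps of a product cone *)

Lemma le_prod_norm (R : realType) (n : nat) (S : finType) (x : S -> 'cV[R]_n) s i :
  `|x s i ord0| <= prod_norm x.
Proof.
apply: le_trans (le_bigmax 0 (fun s => `|x s|) s).
by rewrite [leRHS]mx_normrE (le_bigmax 0 (fun ij => `|x s ij.1 ij.2|) (i, ord0)).
Qed.

Lemma prod_norm_le (R : realType) (n : nat) (S : finType) (x : S -> 'cV[R]_n) (c : R) :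
  0 <= c -> (forall s i, `|x s i ord0| <= c) -> prod_norm x <= c.
Proof.
move=> c_ge0 xc; apply: bigmax_le => // s _; rewrite [leLHS]mx_normrE.
by apply: bigmax_le => // -[i j] _ /=; rewrite ord1.
Qed.

(* Taking [e = 0] in [cone_map_lip] gives monotonicity. *)
Record cone_map (R : realType) (n : nat) (S : finType)
    (T : (S -> 'cV[R]_n) -> S -> 'cV[R]_n) (L : R) : Prop := ConeMap {
  cone_map_L_ge0 : 0 <= L;
  cone_map_ge0 : forall x, prod_nncone x -> prod_nncone (T x);
  cone_map_lip : forall x y e, 0 <= e -> prod_nncone x -> prod_nncone y ->
    (forall s i, x s i ord0 <= y s i ord0 + e) ->
    forall s i, T x s i ord0 <= T y s i ord0 + L * e;
  cone_map_hom : forall t x, 0 <= t -> prod_nncone x ->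
    forall s, T (fun s => t *: x s) s = t *: T x s }.

Lemma prod_nncone_ge0 (R : realType) (n : nat) (S : finType) (x : S -> 'cV[R]_n) s i :
  prod_nncone x -> 0 <= x s i ord0.
Proof. by move=> /(_ s) /(_ i); rewrite mxE. Qed.

Lemma prod_nnconeP (R : realType) (n : nat) (S : finType) (x : S -> 'cV[R]_n) :
  (forall s i, 0 <= x s i ord0) -> prod_nncone x.
Proof. by move=> x_ge0 s i; rewrite mxE. Qed.

Lemma cone_map_mono (R : realType) (n : nat) (S : finType)
    (T : (S -> 'cV[R]_n) -> S -> 'cV[R]_n) (L : R) (HT : cone_map T L)
    (x y : S -> 'cV[R]_n) :
  prod_nncone x -> (forall s i, x s i ord0 <= y s i ord0) ->
  forall s i, T x s i ord0 <= T y s i ord0.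
Proof.
move=> x_ge0 xy s i; rewrite -[leRHS]addr0 -[X in _ + X](mulr0 L).
apply: cone_map_lip => // [|s' i']; last by rewrite addr0.
by apply: prod_nnconeP => s' i'; apply: le_trans (xy s' i'); exact: prod_nncone_ge0.
Qed.

Lemma iter_cone_map_ge0 (R : realType) (n : nat) (S : finType)
    (T : (S -> 'cV[R]_n) -> S -> 'cV[R]_n) (L : R) (HT : cone_map T L)
    (x : S -> 'cV[R]_n) k :
  prod_nncone x -> prod_nncone (iter k T x).
Proof. by move=> x_ge0; elim: k => //= k; exact: (cone_map_ge0 HT). Qed.

Lemma iter_supersolution (R : realType) (n : nat) (S : finType)
    (T : (S -> 'cV[R]_n) -> S -> 'cV[R]_n) (L : R) (HT : cone_map T L)
    (x z : S -> 'cV[R]_n) (mu C : R) k :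
  0 <= mu -> 0 <= C -> prod_nncone x -> prod_nncone z ->
  (forall s i, T z s i ord0 <= mu * z s i ord0) ->
  (forall s i, x s i ord0 <= C * z s i ord0) ->
  forall s i, iter k T x s i ord0 <= C * mu ^+ k * z s i ord0.
Proof.
move=> mu_ge0 C_ge0 x_ge0 z_ge0 Tz xz; elim: k => [|k IH] s i /=.
  by rewrite mulr1.
have Cmu_ge0 : 0 <= C * mu ^+ k by rewrite mulr_ge0 ?exprn_ge0.
apply: (@le_trans _ _ (T (fun s => (C * mu ^+ k) *: z s) s i ord0)).
  apply: (cone_map_mono HT) => [|s' i']; first exact: iter_cone_map_ge0 HT _ _ x_ge0.
  by rewrite mxE.
by rewrite (cone_map_hom HT)// mxE exprSr mulrA -[leRHS]mulrA ler_wpM2l.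
Qed.

Lemma iter_eigenvector (R : realType) (n : nat) (S : finType)
    (T : (S -> 'cV[R]_n) -> S -> 'cV[R]_n) (L : R) (HT : cone_map T L)
    (x u : S -> 'cV[R]_n) (lambda C : R) k :
  0 <= lambda -> 0 <= C -> prod_nncone x -> prod_nncone u ->
  (forall s, T u s = lambda *: u s) ->
  (forall s i, u s i ord0 <= C * x s i ord0) ->
  forall s i, lambda ^+ k * u s i ord0 <= C * iter k T x s i ord0.
Proof.
move=> la_ge0 C_ge0 x_ge0 u_ge0 Tu ux; elim: k => [|k IH] s i /=.
  by rewrite mul1r.
have Tx_ge0 := iter_cone_map_ge0 HT k x_ge0.
have lak_ge0 : 0 <= lambda ^+ k by rewrite exprn_ge0.
have := cone_map_mono HT (x := fun s => lambda ^+ k *: u s)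
  (y := fun s => C *: iter k T x s).
rewrite exprSr -mulrA => h.
have := h _ _ s i; rewrite !(cone_map_hom HT)// Tu !mxE; apply.
  by apply: prod_nnconeP => s' i'; rewrite mxE mulr_ge0// prod_nncone_ge0.
by move=> s' i'; rewrite !mxE.
Qed.

Lemma interior_prod_nncone_gt0 (R : realType) (n : nat) (S : finType)
    (x : S -> 'cV[R]_n) :
  interior (@prod_nncone R n S : set (prod_topology (fun=> 'cV[R]_n))) x ->
  forall s i, 0 < x s i ord0.
Proof.
move=> x_int s i.
(* [dfwith] varies the component [s] alone, which reduces the product neighbourhood to a ball in one
   factor; lowering [x s] by [e / 2] stays in that ball and hence in the cone. *)
pose K := fun _ : S => 'cV[R]_n : topologicalType.
have : nbhs (dfwith x s (x s) : prod_topology K) (@prod_nncone R n S).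
  have -> : dfwith x s (x s) = x by apply/funext => t; case: dfwithP.
  exact: x_int.
move=> /(@dfwith_continuous S K x s (x s)) /nbhs_ballP[e /= e_gt0 xe].
pose y : 'cV[R]_n := x s - const_mx (e / 2).
have /xe /(_ s) /(_ i) : ball (x s) e y.
  split => // j k; rewrite /ball /= !mxE opprB addrC subrK gtr0_norm; lra.
by rewrite dfwithin !mxE; move: e_gt0; lra.
Qed.

(** An explicit interior point: without one, [is_cone_spectral_radius] would hold vacuously and not
    determine its value. *)
Lemma interior_prod_nncone1 (R : realType) (n : nat) (S : finType) :
  interior (@prod_nncone R n S : set (prod_topology (fun=> 'cV[R]_n)))
    (fun=> const_mx 1).
Proof.
pose K := fun _ : S => 'cV[R]_n : topologicalType.
pose x : prod_topology K := fun=> const_mx 1.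
have near_x s : nbhs x [set y : prod_topology K | nncone (y s)].
  have near_xs := @proj_continuous _ K s x (ball (x s) 1) (nbhsx_ballx _ _ ltr01).
  apply: (@filterS _ _ (nbhs_filter x) _ _ _ near_xs).
  move=> y /= [_ yx] i; have := yx i ord0.
  by rewrite /ball /= !mxE ltr_norml; lra.
exact: (@filter_forall _ S _ _ (nbhs_filter x) near_x).
Qed.

(** Flattening families of vectors to real functions on [S * 'I_n] reduces this to [cw_eigenvector].
    The positive supersolutions for every [mu > r] are recorded because they later bound the growth
    of iterates from above. *)
Lemma cone_map_eigenvector (R : realType) (n : nat) (S : finType)
    (T : (S -> 'cV[R]_n) -> S -> 'cV[R]_n) (L : R) (HT : cone_map T L)
    (s0 : S) (i0 : 'I_n) :
  exists (r : R) (u : S -> 'cV[R]_n),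
    [/\ 0 <= r, prod_nncone u, exists s i, u s i ord0 != 0,
        forall s, T u s = r *: u s
      & forall mu, r < mu -> exists2 z : S -> 'cV[R]_n,
          forall s i, 0 < z s i ord0 &
          forall s i, T z s i ord0 <= mu * z s i ord0].
Proof.
pose unflat (y : S * 'I_n -> R) (s : S) : 'cV[R]_n := \col_i y (s, i).
pose F (y : S * 'I_n -> R) (si : S * 'I_n) : R := T (unflat y) si.1 si.2 ord0.
have unflatE y s i : unflat y s i ord0 = y (s, i) by rewrite /unflat mxE.
have unflat_ge0 y : (forall si, 0 <= y si) -> prod_nncone (unflat y).
  by move=> y_ge0; apply: prod_nnconeP => s i; rewrite unflatE.
have F_ge0 y : (forall si, 0 <= y si) -> forall si, 0 <= F y si.
  by move=> y_ge0 [s i]; exact: prod_nncone_ge0 (cone_map_ge0 HT (unflat_ge0 _ y_ge0)).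
have F_lip (y z : S * 'I_n -> R) (e : R) :
    0 <= e -> (forall si, 0 <= y si) -> (forall si, 0 <= z si) ->
    (forall si, y si <= z si + e) -> forall si, F y si <= F z si + L * e.
  move=> e_ge0 y_ge0 z_ge0 yz [s i].
  apply: (cone_map_lip HT) => // [||s' i']; first exact: unflat_ge0.
    exact: unflat_ge0.
  by rewrite !unflatE.
have F_hom (t : R) (y : S * 'I_n -> R) : 0 <= t -> (forall si, 0 <= y si) ->
    forall si, F (fun sj => t * y sj) si = t * F y si.
  move=> t_ge0 y_ge0 [s i]; rewrite /F /=.
  have -> : unflat (fun sj => t * y sj) = fun s => t *: unflat y s.
    by apply/funext => s'; apply/colP => j; rewrite /unflat !mxE.
  by rewrite (cone_map_hom HT) ?mxE//; exact: unflat_ge0.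
have [u [u_ge0 [[s i] u_neq0] Fu]] :=
  cw_eigenvector (s0, i0) (cone_map_L_ge0 HT) F_ge0 F_lip F_hom.
exists (cw_number F), (unflat u); split.
- apply: lb_le_inf; first exact: cw_bounds_neq0.
  exact: (cw_bounds_ge0 (s0, i0) F_ge0).
- exact: unflat_ge0.
- by exists s, i; rewrite unflatE.
- by move=> s'; apply/colP => j; have := Fu (s', j); rewrite /F /unflat /= !mxE.
move=> mu mu_gt.
have [nu [y y_gt0 Fy] nu_lt] := inf_lt (cw_bounds_neq0 F) mu_gt.
exists (unflat y) => s' i'; rewrite unflatE//.
apply: le_trans (Fy (s', i')) _.
by rewrite ler_wpM2r ?ltW.
Qed.

(** As [x] is positive, [u <= C x] for some [C], and iterating gives [lambda^k u <= C T^k x]. A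
    nonzero entry of [u] then yields the constant. *)
Lemma eigenvector_growth (R : realType) (n : nat) (S : finType)
    (T : (S -> 'cV[R]_n) -> S -> 'cV[R]_n) (L : R) (HT : cone_map T L)
    (lambda : R) (u x : S -> 'cV[R]_n) :
  0 <= lambda -> prod_nncone u -> (exists s i, u s i ord0 != 0) ->
  (forall s, T u s = lambda *: u s) -> (forall s i, 0 < x s i ord0) ->
  exists2 c, 0 < c & forall k, c * lambda ^+ k <= prod_norm (iter k T x).
Proof.
move=> la_ge0 u_ge0 [s [i u_neq0]] Tu x_gt0.
have x_ge0 : prod_nncone x by apply: prod_nnconeP => s' i'; exact: ltW.
have u_gt0 : 0 < u s i ord0 by rewrite lt_def u_neq0 prod_nncone_ge0.
pose C := \big[Num.max/0]_(si : S * 'I_n) (u si.1 si.2 ord0 / x si.1 si.2 ord0).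
have ux s' i' : u s' i' ord0 <= C * x s' i' ord0.
  rewrite -ler_pdivrMr//.
  exact: (le_bigmax 0
    (fun si : S * 'I_n => u si.1 si.2 ord0 / x si.1 si.2 ord0) (s', i')).
have C_gt0 : 0 < C.
  by have := lt_le_trans u_gt0 (ux s i); rewrite pmulr_lgt0.
exists (u s i ord0 / C) => [|k]; first exact: divr_gt0.
rewrite mulrAC ler_pdivrMr// mulrC.
have := iter_eigenvector HT k la_ge0 (ltW C_gt0) x_ge0 u_ge0 Tu ux s i.
move=> /le_trans; apply; rewrite mulrC ler_pM2r//.
exact: le_trans (ler_norm _) (le_prod_norm _ _ _).
Qed.

(** The dual bound: [x <= C z] propagates to [T^k x <= C mu^k z]. *)
Lemma supersolution_growth (R : realType) (n : nat) (S : finType)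
    (T : (S -> 'cV[R]_n) -> S -> 'cV[R]_n) (L : R) (HT : cone_map T L)
    (mu : R) (z x : S -> 'cV[R]_n) :
  0 <= mu -> prod_nncone x -> (forall s i, 0 < z s i ord0) ->
  (forall s i, T z s i ord0 <= mu * z s i ord0) ->
  exists C, forall k, prod_norm (iter k T x) <= C * mu ^+ k.
Proof.
move=> mu_ge0 x_ge0 z_gt0 Tz.
have z_ge0 : prod_nncone z by apply: prod_nnconeP => s' i'; exact: ltW.
pose C := \big[Num.max/0]_(si : S * 'I_n) (x si.1 si.2 ord0 / z si.1 si.2 ord0).
have C_ge0 : 0 <= C by exact: bigmax_ge_id.
have xz s i : x s i ord0 <= C * z s i ord0.
  rewrite -ler_pdivrMr//.
  exact: (le_bigmax 0
    (fun si : S * 'I_n => x si.1 si.2 ord0 / z si.1 si.2 ord0) (s, i)).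
have Cmu_ge0 k : 0 <= C * mu ^+ k by rewrite mulr_ge0 ?exprn_ge0.
exists (C * prod_norm z) => k; rewrite mulrAC.
have z_norm s i : z s i ord0 <= prod_norm z.
  exact: le_trans (ler_norm _) (le_prod_norm _ _ _).
apply: prod_norm_le => [|s i].
  by rewrite mulr_ge0// bigmax_ge_id.
rewrite ger0_norm; last exact: prod_nncone_ge0 (iter_cone_map_ge0 HT _ x_ge0).
apply: le_trans (iter_supersolution HT k mu_ge0 C_ge0 x_ge0 z_ge0 Tz xz s i) _.
exact: ler_wpM2l.
Qed.

Lemma eigenvalue_le_cone_spectral_radius (R : realType) (n : nat) (S : finType)
    (T : (S -> 'cV[R]_n) -> S -> 'cV[R]_n) (L : R) (HT : cone_map T L)
    (lambda : R) (u : S -> 'cV[R]_n) :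
  0 <= lambda -> prod_nncone u -> (exists s i, u s i ord0 != 0) ->
  (forall s, T u s = lambda *: u s) -> lambda <= cone_spectral_radius T.
Proof.
move=> la_ge0 u_ge0 u_neq0 Tu; have [s [i _]] := u_neq0.
have [r [v [r_ge0 v_ge0 v_neq0 Tv super]]] := cone_map_eigenvector HT s i.
pose e1 : S -> 'cV[R]_n := fun=> const_mx 1.
have e1_gt0 s' i' : 0 < e1 s' i' ord0 by rewrite mxE.
have r_rad : is_cone_spectral_radius T r.
  move=> x /interior_prod_nncone_gt0 x_gt0.
  have [c c_gt0 lo] := eigenvector_growth HT r_ge0 v_ge0 v_neq0 Tv x_gt0.
  apply: (cvg_root_growth c_gt0 r_ge0 lo) => mu r_mu.
  have [z z_gt0 Tz] := super mu r_mu.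
  apply: (supersolution_growth HT) z_gt0 Tz; first exact: le_trans (ltW r_mu).
  by apply: prod_nnconeP => s' i'; exact: ltW.
(* The value chosen by [get] is pinned down by uniqueness of the limit along the orbit of the
   all-ones vector. *)
have -> : cone_spectral_radius T = r.
  apply: get_unique => // r' /(_ _ (interior_prod_nncone1 R n S)) r'_lim.
  apply: (cvg_unique _ r'_lim); first exact: Rhausdorff.
  exact: r_rad (interior_prod_nncone1 R n S).
have [c c_gt0 lo] := eigenvector_growth HT la_ge0 u_ge0 u_neq0 Tu e1_gt0.
exact: geometric_le_root_lim c_gt0 la_ge0 lo (r_rad _ (interior_prod_nncone1 R n S)).
Qed.

(** * The path operator and max-linear functions *)

Lemma path_operatorE (R : realType) (n p d : nat) (A : 'I_p -> 'M[R]_n)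
    (x : d.-tuple 'I_p -> 'cV[R]_n) s i :
  path_operator A x s i ord0 =
  \big[Num.max/0]_(ra : d.-tuple 'I_p * 'I_p | tau ra.1 ra.2 == s)
    \sum_j A ra.2 j i * x ra.1 j ord0.
Proof.
rewrite mxE; apply: eq_bigr => ra _; rewrite mxE.
by apply: eq_bigr => j _; rewrite mxE.
Qed.

Lemma path_operator_cone_map (R : realType) (n p d : nat) (A : 'I_p -> 'M[R]_n)
    (A_ge0 : forall a i j, 0 <= A a i j) :
  exists L : R, cone_map (@path_operator R n p d A) L.
Proof.
(* The largest column sum: adding [e] to every entry of [x] raises each entry of [A_a^T x] by [e]
   times a column sum of [A_a]. *)
pose L := \big[Num.max/0]_(ai : 'I_p * 'I_n) \sum_j A ai.1 j ai.2.
exists L; split.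
- exact: bigmax_ge_id.
- by move=> x _; apply: prod_nnconeP => s i; rewrite path_operatorE bigmax_ge_id.
- move=> x y e e_ge0 x_ge0 y_ge0 xy s i; rewrite !path_operatorE.
  apply: bigmax_le => [|ra ra_s].
    by rewrite addr_ge0 ?mulr_ge0 ?bigmax_ge_id.
  apply: (@le_trans _ _ (\sum_j A ra.2 j i * (y ra.1 j ord0 + e))).
    by apply: ler_sum => j _; rewrite ler_wpM2l.
  under eq_bigr do rewrite mulrDr.
  rewrite big_split /= -mulr_suml lerD//.
    exact: (le_bigmax_cond 0 (fun ra => \sum_j A ra.2 j i * y ra.1 j ord0)).
  rewrite ler_wpM2r//.
  exact: (le_bigmax 0 (fun ai : 'I_p * 'I_n => \sum_j A ai.1 j ai.2) (ra.2, i)).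
- move=> t x t_ge0 _ s; apply/colP => i; rewrite path_operatorE mxE path_operatorE.
  rewrite (big_morph ( *%R t) (fun y z => maxr_pMr y z t_ge0) (mulr0 t)).
  apply: eq_bigr => ra _; rewrite mulr_sumr; apply: eq_bigr => j _.
  by rewrite mxE mulrCA.
Qed.

Lemma dotE (R : realType) (n : nat) (x y : 'cV[R]_n) : dot x y = (x^T *m y) ord0 ord0.
Proof. by rewrite mxE; apply: eq_bigr => i _; rewrite mxE. Qed.

Lemma dot_trmx (R : realType) (n : nat) (M : 'M[R]_n) (x y : 'cV[R]_n) :
  dot x (M *m y) = dot (M^T *m x) y.
Proof. by rewrite !dotE trmx_mul trmxK mulmxA. Qed.

Lemma dot_convl (R : realType) (n : nat) (u x y : 'cV[R]_n) (a b : R) :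
  dot u (a *: x + b *: y) = a * dot u x + b * dot u y.
Proof. by rewrite !dotE mulmxDr -!scalemxAr !mxE. Qed.

Lemma ler_dot (R : realType) (n : nat) (u v x y : 'cV[R]_n) :
  nncone u -> nncone x -> vle u v -> vle x y -> dot u x <= dot v y.
Proof.
move=> u_ge0 x_ge0 uv xy; apply: ler_sum => i _.
by apply: ler_pM => //; [have := u_ge0 i | have := x_ge0 i]; rewrite mxE.
Qed.

Lemma dot_ge_term (R : realType) (n : nat) (u x : 'cV[R]_n) i :
  nncone u -> nncone x -> u i ord0 * x i ord0 <= dot u x.
Proof.
move=> u_ge0 x_ge0; rewrite /dot (bigD1 i)//= lerDl; apply: sumr_ge0 => j _.
by apply: mulr_ge0; [have := u_ge0 j | have := x_ge0 j]; rewrite mxE.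
Qed.

Lemma max_linear_ge0 (R : realType) (n : nat) (S : finType) (u : S -> 'cV[R]_n) x :
  0 <= max_linear u x.
Proof. exact: bigmax_ge_id. Qed.

Lemma dot_le_max_linear (R : realType) (n : nat) (S : finType)
    (u : S -> 'cV[R]_n) x s : dot (u s) x <= max_linear u x.
Proof. exact: (le_bigmax 0 (fun s => dot (u s) x)). Qed.

(** Convexity, homogeneity and monotonicity pass from linear forms with nonnegative coefficients to
    their maximum. Definiteness holds because each coordinate has a positive coefficient in some
    [u s]. *)
Lemma max_linear_monotone_heminorm (R : realType) (n : nat) (S : finType)
    (u : S -> 'cV[R]_n) :
  prod_nncone u -> (forall i, exists s, 0 < u s i ord0) ->
  monotone_heminorm (max_linear u).
Proof.
move=> u_ge0 u_gt0; split.
- move=> t x y _ _; rewrite convRE.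
  have t_ge0 : 0 <= t%:num :> R by [].
  have t'_ge0 : 0 <= 1 - t%:num :> R by rewrite subr_ge0.
  apply: bigmax_le => [|s _].
    by apply: addr_ge0; apply: mulr_ge0; rewrite // max_linear_ge0.
  rewrite [leLHS]dot_convl.
  by apply: lerD; apply: ler_wpM2l => //; exact: dot_le_max_linear.
- move=> t x t_gt0 _; rewrite /max_linear.
  rewrite (big_morph ( *%R t) (fun y z => maxr_pMr y z (ltW t_gt0)) (mulr0 t)).
  apply: eq_bigr => s _; rewrite -[t *: x]addr0 -(scale0r (0 : 'cV[R]_n)).
  by rewrite dot_convl mul0r addr0.
- move=> x y x_ge0 xy; apply: bigmax_le => [|s _]; first exact: max_linear_ge0.
  apply: le_trans (dot_le_max_linear _ _ s).
  by apply: ler_dot => // i; rewrite lexx.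
- move=> x x_ge0 ux0; apply/colP => i; rewrite [RHS]mxE.
  have [s us_gt0] := u_gt0 i.
  have xi_ge0 : 0 <= x i ord0 by have := x_ge0 i; rewrite mxE.
  apply/eqP; rewrite eq_le xi_ge0 andbT -(pmulr_rle0 _ us_gt0) -ux0.
  exact: le_trans (dot_ge_term i (u_ge0 s) x_ge0) (dot_le_max_linear _ _ _).
Qed.

(** * The joint spectral radius *)

(* Fekete's argument, with [r] the infimum of [b k `^ k^-1] over [k > 0]. *)
Lemma submultiplicative_growth (R : realType) (b : nat -> R)
    (b_ge0 : forall k, 0 <= b k) (b0_ge1 : 1 <= b 0)
    (bD : forall k l, b (k + l)%N <= b k * b l) :
  exists r : R, [/\ 0 <= r, forall k, r ^+ k <= b k
    & forall mu, r < mu -> exists C, forall k, b k <= C * mu ^+ k].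
Proof.
pose E := [set b k.+1 `^ k.+1%:R^-1 | k in [set: nat]].
have E_neq0 : E !=set0 by exists (b 1 `^ 1%:R^-1), 0%N.
have E_ge0 : lbound E 0 by move=> _ [k _ <-]; exact: powR_ge0.
have rootK k : (b k.+1 `^ k.+1%:R^-1) ^+ k.+1 = b k.+1.
  by rewrite -powR_mulrn ?powR_ge0// -powRrM mulVf ?pnatr_eq0// powRr1.
have r_ge0 : 0 <= inf E by exact: lb_le_inf.
exists (inf E); split => // [[|k]|mu r_mu]; first exact: b0_ge1.
  rewrite -rootK lerXn2r// ?nnegrE ?powR_ge0//.
  by apply: ge_inf; [exists 0 | exists k].
have mu_gt0 := le_lt_trans r_ge0 r_mu.
have [_ [k _ <-] bk_mu] := inf_lt E_neq0 r_mu.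
have bk_le : b k.+1 <= mu ^+ k.+1.
  by rewrite -rootK lerXn2r// ?nnegrE ?powR_ge0 ?(ltW mu_gt0) ?(ltW bk_mu).
(* Division with remainder: full blocks of length [k.+1] cost [mu ^+ k.+1] each, and the finitely
   many remainders [j < k.+1] are absorbed in the constant. *)
have b_le q j : b (q * k.+1 + j)%N <= mu ^+ (q * k.+1) * b j.
  elim: q => [|q IH]; first by rewrite mul1r.
  rewrite mulSn -addnA exprD -mulrA; apply: le_trans (bD _ _) _.
  exact: ler_pM.
exists (\big[Num.max/0]_(j < k.+1) (b j / mu ^+ j)) => l.
rewrite (divn_eq l k.+1); apply: le_trans (b_le _ _) _.
rewrite exprD mulrCA ler_pM2l ?exprn_gt0// -ler_pdivrMr ?exprn_gt0//.
have lt_mod : (l %% k.+1 < k.+1)%N by rewrite ltn_pmod.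
exact: (le_bigmax 0 (fun j : 'I_k.+1 => b j / mu ^+ j) (Ordinal lt_mod)).
Qed.

Lemma ler_mx_entry (R : realType) (m n : nat) (M : 'M[R]_(m, n)) i j :
  `|M i j| <= `|M|.
Proof. by rewrite [leRHS]mx_normrE (le_bigmax 0 (fun ij => `|M ij.1 ij.2|) (i, j)). Qed.

Lemma mx_norm_le (R : realType) (m n : nat) (M : 'M[R]_(m, n)) (c : R) :
  0 <= c -> (forall i j, `|M i j| <= c) -> `|M| <= c.
Proof. by move=> c_ge0 Mc; rewrite [leLHS]mx_normrE; apply: bigmax_le => // -[i j]. Qed.

(** The entrywise sup norm is submultiplicative only up to a factor [n], as each entry of the
    product is a sum of [n] terms. *)
Lemma mx_norm_mulmx (R : realType) (n : nat) (M N : 'M[R]_n) :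
  `|M *m N| <= n%:R * (`|M| * `|N|).
Proof.
apply: mx_norm_le => [|i j]; first by rewrite !mulr_ge0.
rewrite mxE; apply: le_trans (ler_norm_sum _ _ _) _.
rewrite -[n in n%:R]card_ord mulr_natl -sumr_const; apply: ler_sum => k _.
by rewrite normrM ler_pM// ler_mx_entry.
Qed.

Definition word_mx (R : realType) (n p : nat) (A : 'I_p -> 'M[R]_n)
    (w : seq 'I_p) : 'M[R]_n :=
  \big[mulmx/1%:M]_(a <- w) A a.

Definition max_word_norm (R : realType) (n p : nat) (A : 'I_p -> 'M[R]_n)
    (k : nat) : R :=
  \big[Num.max/0]_(w : k.-tuple 'I_p) `|word_mx A w|.

Lemma word_mx_cat (R : realType) (n p : nat) (A : 'I_p -> 'M[R]_n) w1 w2 :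
  word_mx A (w1 ++ w2) = word_mx A w1 *m word_mx A w2.
Proof.
rewrite /word_mx; elim: w1 => [|a w1 IH] /=; first by rewrite big_nil mul1mx.
by rewrite !big_cons IH mulmxA.
Qed.

Lemma le_max_word_norm (R : realType) (n p : nat) (A : 'I_p -> 'M[R]_n) w k :
  size w = k -> `|word_mx A w| <= max_word_norm A k.
Proof.
move=> <-.
exact: (le_bigmax 0
  (fun v : (size w).-tuple 'I_p => `|word_mx A v|) (in_tuple w)).
Qed.

Lemma max_word_normD (R : realType) (n p : nat) (A : 'I_p -> 'M[R]_n) k l :
  max_word_norm A (k + l) <= n%:R * (max_word_norm A k * max_word_norm A l).
Proof.
have m_ge0 j : 0 <= max_word_norm A j by exact: bigmax_ge_id.
apply: bigmax_le => [|w _]; first by rewrite !mulr_ge0.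
rewrite -(cat_take_drop k w) word_mx_cat; apply: le_trans (mx_norm_mulmx _ _) _.
rewrite ler_wpM2l// ler_pM// le_max_word_norm//.
  by rewrite size_takel// size_tuple leq_addr.
by rewrite size_drop size_tuple addKn.
Qed.

(** Rescaling by [n] makes the sequence truly submultiplicative, and the factor vanishes under the
    roots. This turns the [lim] in the definition into an actual limit. *)
Lemma joint_spectral_radius_cvg (R : realType) (n p : nat) (A : 'I_p -> 'M[R]_n) :
  (0 < n)%N ->
  (fun k : nat => max_word_norm A k `^ k%:R^-1) @ \oo --> joint_spectral_radius A.
Proof.
move=> n_gt0; have nR_gt0 : 0 < n%:R :> R by rewrite ltr0n.
pose b k := n%:R * max_word_norm A k.
have m_ge0 j : 0 <= max_word_norm A j by exact: bigmax_ge_id.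
have [||k l|r [r_ge0 r_le r_gt]] := @submultiplicative_growth R b.
- by move=> k; rewrite mulr_ge0.
(* The empty word gives the identity matrix, whose norm is at least 1 because it has a diagonal
   entry. *)
- have i := Ordinal n_gt0.
  have : `|(1%:M : 'M[R]_n) i i| <= max_word_norm A 0.
    apply: le_trans (ler_mx_entry _ _ _) _.
    by have := le_max_word_norm A (erefl (size [::])); rewrite /word_mx big_nil.
  rewrite !mxE eqxx normr1 => m0_ge1.
  by rewrite /b -[X in X <= _]mulr1 ler_pM// ler1n.
- by rewrite /b mulrACA -mulrA ler_pM2l// max_word_normD.
have r_lim : (fun k : nat => max_word_norm A k `^ k%:R^-1) @ \oo --> r.
  apply: (@cvg_root_growth _ _ n%:R^-1) => // [|k|mu r_mu].
  - by rewrite invr_gt0.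
  - by rewrite mulrC ler_pdivrMr// mulrC; exact: r_le.
  - have [C bC] := r_gt mu r_mu; exists (n%:R^-1 * C) => k.
    by rewrite -mulrA mulrC ler_pdivlMr// mulrC; exact: bC.
by rewrite /joint_spectral_radius (cvg_lim _ r_lim)//; exact: Rhausdorff.
Qed.

Lemma word_mx_ge0 (R : realType) (n p : nat) (A : 'I_p -> 'M[R]_n) w :
  (forall a i j, 0 <= A a i j) -> forall i j, 0 <= word_mx A w i j.
Proof.
move=> A_ge0; rewrite /word_mx; elim: w => [|a w IH] i j.
  by rewrite big_nil mxE ler0n.
by rewrite big_cons mxE sumr_ge0// => k _; rewrite mulr_ge0.
Qed.

Lemma mulmx_nncone (R : realType) (n : nat) (M : 'M[R]_n) (x : 'cV[R]_n) :
  (forall i j, 0 <= M i j) -> nncone x -> nncone (M *m x).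
Proof.
move=> M_ge0 x_ge0 i; rewrite !mxE sumr_ge0// => j _.
by rewrite mulr_ge0//; have := x_ge0 j; rewrite mxE.
Qed.

(** Iterating the extremal inequality bounds a word of length [k] applied to a basis vector by
    [lambda^k] in the hemi-norm, and the positive weights [u (sel i) i] convert this into a bound on
    every matrix entry. *)
Lemma joint_spectral_radius_le (R : realType) (n p : nat) (S : finType)
    (A : 'I_p -> 'M[R]_n) (u : S -> 'cV[R]_n) (lambda : R) :
  (0 < n)%N -> (forall a i j, 0 <= A a i j) -> 0 <= lambda ->
  prod_nncone u -> (forall i, exists s, 0 < u s i ord0) ->
  (forall a x, nncone x -> max_linear u (A a *m x) <= lambda * max_linear u x) ->
  joint_spectral_radius A <= lambda.
Proof.
move=> n_gt0 A_ge0 la_ge0 u_ge0 /choice[sel u_gt0] uA.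
have uw w x : nncone x ->
    max_linear u (word_mx A w *m x) <= lambda ^+ size w * max_linear u x.
  move=> x_ge0; elim: w => [|a w IH]; first by rewrite /word_mx big_nil mul1mx mul1r.
  rewrite /word_mx big_cons -mulmxA -/(word_mx A w) exprS -mulrA.
  apply: le_trans (uA _ _ _) _; last exact: ler_wpM2l.
  exact/mulmx_nncone/x_ge0/word_mx_ge0.
pose e j : 'cV[R]_n := delta_mx j ord0.
have e_ge0 j : nncone (e j) by move=> i; rewrite !mxE ler0n.
pose C := \big[Num.max/0]_(ij : 'I_n * 'I_n)
  (max_linear u (e ij.2) / u (sel ij.1) ij.1 ord0).
have C1_gt0 : 0 < C + 1.
  by rewrite ltr_wpDl// bigmax_ge_id.
apply: (root_lim_le_geometric C1_gt0 la_ge0 _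
  (@joint_spectral_radius_cvg _ _ _ A n_gt0)).
move=> k; rewrite bigmax_ge_id/=.
have lak_ge0 : 0 <= lambda ^+ k by rewrite exprn_ge0.
have bound_ge0 : 0 <= (C + 1) * lambda ^+ k by rewrite mulr_ge0// ltW.
apply: bigmax_le => // w _; apply: mx_norm_le => // i j.
rewrite ger0_norm; last exact: word_mx_ge0.
apply: (@le_trans _ _ (C * lambda ^+ k)); last first.
  by rewrite ler_wpM2r// lerDl.
apply: (@le_trans _ _
  (max_linear u (e j) / u (sel i) i ord0 * lambda ^+ k)); last first.
  rewrite ler_wpM2r//.
  exact: (le_bigmax 0 (fun ij : 'I_n * 'I_n =>
    max_linear u (e ij.2) / u (sel ij.1) ij.1 ord0) (i, j)).
rewrite mulrAC ler_pdivlMr// [leRHS]mulrC.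
have := uw w (e j) (e_ge0 j); rewrite size_tuple; apply: le_trans.
(* Entry [(i, j)] of the word is coordinate [i] of its product with [e j], and the form [u (sel i)]
   weighs that coordinate positively. *)
apply: le_trans (dot_le_max_linear _ _ (sel i)).
apply: le_trans (dot_ge_term i (u_ge0 _) _); last exact/mulmx_nncone/e_ge0/word_mx_ge0.
by rewrite -colE mxE mulrC.
Qed.

(** * Eigenvectors of the path operator *)

Lemma path_eigenpair_le (R : realType) (n p d : nat) (A : 'I_p -> 'M[R]_n)
    (lambda : R) (u : d.-tuple 'I_p -> 'cV[R]_n) r a :
  path_eigenpair A lambda u -> vle ((A a)^T *m u r) (lambda *: u (tau r a)).
Proof.
move=> [_ _ Tu] i; have <- : path_operator A u (tau r a) = lambda *: u (tau r a).
  by rewrite Tu.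
rewrite [leRHS]mxE.
by apply: (bigmax_sup (r, a)) => //=; exact: eqxx.
Qed.

(* The coordinates on which all [u_s] vanish span a face that is invariant under
   every [A a], since [A a^T u_r <= lambda u_s] for [s = tau r a]. *)
Lemma path_eigenpair_gt0 (R : realType) (n p d : nat) (A : 'I_p -> 'M[R]_n)
    (lambda : R) (u : d.-tuple 'I_p -> 'cV[R]_n)
    (A_ge0 : forall a i j, 0 <= A a i j) (A_irr : positively_irreducible A) :
  path_eigenpair A lambda u -> forall i, exists s, 0 < u s i ord0.
Proof.
move=> eig; have [u_ge0 u_neq0 _] := eig.
pose J : {set 'I_n} := [set i | [forall s, u s i ord0 == 0]]%SET.
have JP i : reflect (forall s, u s i ord0 = 0) (i \in J).
  rewrite inE; apply: (iffP forallP) => h s; first exact/eqP.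
  by rewrite h.
have NJP i : i \notin J -> exists s, 0 < u s i ord0.
  rewrite inE negb_forall => /existsP[s us]; exists s.
  by rewrite lt_def us prod_nncone_ge0.
suff J0 : J = finset.set0 by move=> i; apply: NJP; rewrite J0 inE.
have [//|J_neq0] := pselect (J = finset.set0); exfalso.
apply: (A_irr J J_neq0) => [JT|a x [x_ge0 xJ]].
  apply: u_neq0; apply/funext => s; apply/colP => i; rewrite [RHS]mxE.
  by apply/JP; rewrite JT inE.
split=> [|j jJ]; first exact/mulmx_nncone.
rewrite mxE big1// => i _; have [/JP iJ|iJ] := boolP (i \in J); last first.
  by rewrite xJ// mulr0.
have [s us_gt0] := NJP j jJ.
(* For [i] in [J] the right-hand side is 0, so every term of the nonnegative sum on the left
   vanishes; since [u s j > 0], this forces [A a j i = 0]. *)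
have := path_eigenpair_le s a eig i; rewrite [leRHS]mxE iJ mulr0 mxE.
move=> sum_le0; have term_ge0 k : 0 <= (A a)^T i k * u s k ord0.
  by rewrite mxE mulr_ge0// prod_nncone_ge0.
have : (A a)^T i j * u s j ord0 <= 0.
  by apply: le_trans sum_le0; rewrite (bigD1 j)//= lerDl sumr_ge0.
rewrite mxE pmulr_lle0// => Aji_le0.
by have -> : A a j i = 0; [apply/le_anti; rewrite Aji_le0 A_ge0 | rewrite mul0r].
Qed.

Lemma path_eigenpair_extremal (R : realType) (n p d : nat) (A : 'I_p -> 'M[R]_n)
    (lambda : R) (u : d.-tuple 'I_p -> 'cV[R]_n)
    (A_ge0 : forall a i j, 0 <= A a i j) (la_ge0 : 0 <= lambda) a x :
  path_eigenpair A lambda u -> nncone x ->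
  max_linear u (A a *m x) <= lambda * max_linear u x.
Proof.
move=> eig x_ge0; have [u_ge0 _ _] := eig.
apply: bigmax_le => [|r _]; first by rewrite mulr_ge0 ?max_linear_ge0.
rewrite dot_trmx; apply: (@le_trans _ _ (dot (lambda *: u (tau r a)) x)).
  apply: ler_dot => //; last exact: path_eigenpair_le.
  by apply: mulmx_nncone => // i j; rewrite mxE.
have -> : dot (lambda *: u (tau r a)) x = lambda * dot (u (tau r a)) x.
  by rewrite /dot mulr_sumr; apply: eq_bigr => i _; rewrite mxE mulrA.
by rewrite ler_wpM2l// dot_le_max_linear.
Qed.

Theorem theorem3 (R : realType) (n p d : nat) (A : 'I_p -> 'M[R]_n)
    (n_gt0 : (0 < n)%N) (p_gt0 : (0 < p)%N)
    (A_ge0 : forall a i j, 0 <= A a i j)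
    (A_irr : positively_irreducible A) :
  (exists (lambda : R) (u : d.-tuple 'I_p -> 'cV[R]_n),
     path_eigenpair A lambda u) /\
  (forall (lambda : R) (u : d.-tuple 'I_p -> 'cV[R]_n),
     path_eigenpair A lambda u ->
     [/\ joint_spectral_radius A <= lambda,
         lambda <= cone_spectral_radius (@path_operator R n p d A)
       & monotone_extremal_heminorm A lambda (max_linear u)]).
Proof.
have [L TL] := path_operator_cone_map d A_ge0.
split=> [|lambda u eig].
  have s0 : d.-tuple 'I_p := nseq_tuple d (Ordinal p_gt0).
  have [r [u [_ u_ge0 [s [i u_neq0]] Tu _]]] :=
    cone_map_eigenvector TL s0 (Ordinal n_gt0).
  exists r, u; split => // [u0|]; last exact/funext.
  by move: u_neq0; rewrite u0 mxE eqxx.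
have [u_ge0 _ Tu] := eig.
have u_gt0 := path_eigenpair_gt0 A_ge0 A_irr eig.
have Tus s : path_operator A u s = lambda *: u s by rewrite Tu.
have [s us_gt0] := u_gt0 (Ordinal n_gt0).
(* An eigenpair does not prescribe the sign of [lambda]; it is read off at a positive entry of [u],
   where the image under the operator is nonnegative. *)
have la_ge0 : 0 <= lambda.
  have := prod_nncone_ge0 s (Ordinal n_gt0) (cone_map_ge0 TL u_ge0).
  by rewrite Tus mxE pmulr_lge0.
have extremal a x := path_eigenpair_extremal A_ge0 la_ge0 a (x := x) eig.
split.
- exact: joint_spectral_radius_le u_gt0 extremal.
- apply: eigenvalue_le_cone_spectral_radius TL _ _ la_ge0 u_ge0 _ Tus.
  by exists s, (Ordinal n_gt0); rewrite gt_eqF.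
- split; first exact: max_linear_monotone_heminorm.
  move=> x x_ge0; apply: bigmax_le => [|a _]; last exact: extremal.
  by rewrite mulr_ge0 ?max_linear_ge0.
Qed.
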